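(* For all integers $t,n\ge 2$ we have $R_{nest}(t,n)=2(t(n-1)+1)$.
   Context: The ordered complete graph on $[m]=\{1,\dots,m\}$ is the complete graph with vertex set $[m]$, taken with its natural ordering; edges are written $(i,j)$ with $i<j$. Two edges are independent if they share no vertex; independent edges $(a,b)$ and $(c,d)$ are nested if $a<c<d<b$ or $c<a<b<d$. A matching is a set of pairwise independent edges; it is nested if any two of its edges are nested, and monochromatic if all its edges have the same color. $R_{nest}(t,n)$ denotes the smallest $m$ such that in every coloring of the edges of the ordered complete graph on $[m]$ with $t$ colors there is a monochromatic nested matching with $n$ edges. *)

(* Defs.v *)
From mathcomp Require Import all_boot.

Set Implicit Arguments.
Unset Strict Implicit.
Unset Printing Implicit Defensive.

(* The ordered vertex set [m] = {1, ..., m} is represented by the ordinals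
   0, ..., m - 1 with their natural order. *)
Definition edge (m : nat) : finType := {e : 'I_m * 'I_m | e.1 < e.2}.

Definition lo m (e : edge m) : 'I_m := (val e).1.
Definition hi m (e : edge m) : 'I_m := (val e).2.

Definition independent m (e f : edge m) : bool :=
  [&& lo e != lo f, lo e != hi f, hi e != lo f & hi e != hi f].

Definition nested m (e f : edge m) : bool :=
  [&& lo e < lo f, lo f < hi f & hi f < hi e] ||
  [&& lo f < lo e, lo e < hi e & hi e < hi f].

Definition matching m (M : {set edge m}) : Prop :=
  {in M &, forall e f, e != f -> independent e f}.

Definition nested_matching m (M : {set edge m}) : Prop :=
  matching M /\ {in M &, forall e f, e != f -> nested e f}.

Definition monochromatic m t (c : edge m -> 'I_t) (M : {set edge m}) : Prop :=
  {in M &, forall e f, c e = c f}.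

Definition forces_nested (t n m : nat) : Prop :=
  forall c : edge m -> 'I_t,
    exists M : {set edge m},
      [/\ nested_matching M, monochromatic c M & #|M| = n].

(* [is_Rnest t n m] reads "R_nest(t,n) = m"; it asserts both that R_nest(t,n)
   is well defined and that its value is m. *)
Definition is_Rnest (t n m : nat) : Prop :=
  forces_nested t n m /\ forall m' : nat, forces_nested t n m' -> m <= m'.

(* Main.v *)
(* Upper bound: the edges (i, 2N-1-i), i < N, are pairwise nested, so
   for N = t(n-1)+1 the pigeonhole principle gives n of them of one color.
   Lower bound: in a nested matching the lengths hi - lo of any two edges differ
   by at least 2, so the level floor((hi - lo - 1)/2) is injective on it; coloring
   by blocks of n-1 consecutive levels uses at most t colors when m <= 2t(n-1)+1,
   and leaves room for only n-1 edges in a monochromatic nested matching. *)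
Require Import Defs.
From mathcomp Require Import all_boot.
From mathcomp Require Import zify.

(** Pigeonhole by contraposition: if all fibers have size at most [k], summing over them gives at
    most [#|C| * k] points. *)
Lemma exists_large_fiber (T C : finType) (f : T -> C) (k : nat) :
  #|C| * k < #|T| -> exists j, k < #|[set x | f x == j]|.
Proof.
move=> lt_T; apply/existsP; apply: contraLR lt_T.
rewrite negb_exists -leqNgt => /forallP small.
rewrite -sum1_card (partition_big f predT) //= -sum_nat_const.
apply: leq_sum => j _.
rewrite sum1dep_card leqNgt; exact: small.
Qed.

Lemma exists_subset_card (T : finType) (A : {set T}) (n : nat) :
  n <= #|A| -> exists2 B : {set T}, B \subset A & #|B| = n.
Proof.
rewrite cardE => le_n; exists [set x in take n (enum A)].
  by apply/subsetP => x; rewrite inE => /mem_take; rewrite mem_enum.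
rewrite cardsE (card_uniqP _) ?take_uniq ?enum_uniq //.
exact: size_takel.
Qed.

Lemma nested_independent (m : nat) (e f : edge m) :
  nested e f -> independent e f.
Proof.
have := valP e; have := valP f; rewrite -/(lo e) -/(lo f) -/(hi e) -/(hi f).
rewrite /nested /independent -!val_eqE /=; lia.
Qed.

Fact concentric_lo_subproof {N : nat} (i : 'I_N) : i < 2 * N.
Proof. by have := ltn_ord i; lia. Qed.

Definition concentric_lo {N : nat} (i : 'I_N) : 'I_(2 * N) :=
  Ordinal (concentric_lo_subproof i).

Definition concentric_hi {N : nat} (i : 'I_N) : 'I_(2 * N) :=
  rev_ord (concentric_lo i).

Fact concentric_subproof {N : nat} (i : 'I_N) :
  concentric_lo i < concentric_hi i.
Proof. by rewrite /=; have := ltn_ord i; lia. Qed.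

Definition concentric {N : nat} (i : 'I_N) : edge (2 * N) :=
  exist _ (concentric_lo i, concentric_hi i) (concentric_subproof i).

Lemma concentric_inj (N : nat) : injective (@concentric N).
Proof. by move=> i j /(congr1 (@lo _)) /(congr1 val) /= /val_inj. Qed.

Lemma nested_concentric {N : nat} (i j : 'I_N) :
  i != j -> nested (concentric i) (concentric j).
Proof.
have := ltn_ord i; have := ltn_ord j.
rewrite -val_eqE /nested /lo /hi /=; lia.
Qed.

Lemma forces_nested_concentric (t n N : nat) :
  0 < n -> t * (n - 1) < N -> forces_nested t n (2 * N).
Proof.
move=> n_gt0 ltN c.
(* The pigeonhole acts on the indices [i < N], each colored by the color of its concentric edge. *)
have [|j big_j] := @exists_large_fiber _ _ (c \o @concentric N) (n - 1).
  by rewrite !card_ord.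
rewrite subn1 prednK // in big_j.
have [B sBj cardB] := exists_subset_card _ _ _ big_j.
have nestB : {in @concentric N @: B &, forall e f, e != f -> nested e f}.
  move=> _ _ /imsetP[x _ ->] /imsetP[y _ ->] ne_xy.
  by apply: nested_concentric; apply: contraNneq ne_xy => ->.
exists (@concentric N @: B); split.
- by split=> // e f eB fB ne_ef; apply/nested_independent/nestB.
- move=> _ _ /imsetP[x xB ->] /imsetP[y yB ->].
  have := subsetP sBj x xB; have := subsetP sBj y yB.
  by rewrite !inE => /eqP /= -> /eqP /= ->.
- by rewrite card_imset //; exact: concentric_inj.
Qed.

Definition level {m : nat} (e : edge m) : nat := (hi e - lo e - 1)./2.

Lemma nested_level (m : nat) (e f : edge m) : nested e f -> level e != level f.
Proof.
have := valP e; have := valP f; rewrite -/(lo e) -/(lo f) -/(hi e) -/(hi f).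
rewrite /nested /level; lia.
Qed.

(** A length is at most [m - 1 <= 2 * l], so half of its predecessor, rounded down, stays below [l].
    The bound on [m] is sharp: for [m = 2 * l + 2] the longest edge has level [l]. *)
Lemma level_lt (m l : nat) (e : edge m) : m <= 2 * l + 1 -> level e < l.
Proof.
have := valP e; rewrite -/(lo e) -/(hi e) /level.
have := ltn_ord (hi e); lia.
Qed.

(** Writing [n] as [k.+2] makes the block size [n - 1 = k.+1] visibly positive, as division by it
    requires. *)
Lemma not_forces_nested (t k m : nat) :
  m <= 2 * (t * k.+1) + 1 -> ~ forces_nested t k.+2 m.
Proof.
move=> le_m.
have color_lt (e : edge m) : level e %/ k.+1 < t.
  by rewrite ltn_divLR //; exact: level_lt.
case/(_ (fun e => Ordinal (color_lt e))) => M [[_ nestM] monoM cardM].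
(* The color is the quotient of the level by [k.+1] and [key] is the remainder; inside one color
   class [key] thus determines the level, hence the edge of [M]. *)
pose key (e : edge m) : 'I_k.+1 := Ordinal (ltn_pmod (level e) (ltn0Sn k)).
have key_inj : {in M &, injective key}.
  move=> e f eM fM [eq_mod]; apply/eqP/negP => /negP ne_ef.
  have [eq_div] := monoM e f eM fM.
  have /negP := nested_level _ _ _ (nestM e f eM fM ne_ef); apply; apply/eqP.
  by rewrite (divn_eq (level e) k.+1) eq_div eq_mod -divn_eq.
(* The [k.+2] edges of [M] would inject into [k.+1] remainders. *)
by have := max_card (mem (key @: M)); rewrite card_in_imset // cardM card_ord ltnn.
Qed.

Theorem theorem2p17 (t n : nat) (ht : 2 <= t) (hn : 2 <= n) :
  is_Rnest t n (2 * (t * (n - 1) + 1)).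
Proof.
split; first by apply: forces_nested_concentric; rewrite ?addn1 // ltnW.
case: n hn => [|[|k]] // _ m forced.
rewrite leqNgt; apply/negP => lt_m.
by apply: not_forces_nested forced; move: lt_m; rewrite subn1 /=; lia.
Qed.
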